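(* Let $m(a,b)$ be a strict, isotone, symmetric mean in two variables. For $(a,b,c)\in\mathbb{R}_+^3$ define sequences by $a_0=a$, $b_0=b$, $c_0=c$ and $$a_{n+1}=m(a_n,c_n),\qquad c_{n+1}=m(a_n,b_n),\qquad b_{n+1}=m(c_n,b_n),\qquad n\ge 0,$$ and let $L=L(a,b,c)$ denote the common limit of $\{a_n\},\{b_n\},\{c_n\}$ (all three sequences converge, to the same limit). (A) Define $M(a,b,c)=L(a,b,c)$ for $(a,b,c)\in\mathbb{R}_+^3$. Then $M$ is a mean in three variables and $M$ is invariant with respect to $m$. (B) If $M$ is any mean in three variables that is invariant with respect to $m$, then $M(a,b,c)=L(a,b,c)$ for all $(a,b,c)\in\mathbb{R}_+^3$.
   Context: $\mathbb{R}_+^n=\{(a_1,\dots,a_n)\in\mathbb{R}^n: a_i>0\ \forall i\}$. A mean in $n$ variables is a continuous function $m$ on $\mathbb{R}_+^n$ with $\min(a_1,\dots,a_n)\le m(a_1,\dots,a_n)\le\max(a_1,\dots,a_n)$. It is symmetric if it is unchanged by every permutation of its arguments; strict if $m(a_1,\dots,a_n)$ equals $\min(a_1,\dots,a_n)$ or $\max(a_1,\dots,a_n)$ if and only if $a_1=\cdots=a_n$; isotone if it is an increasing (i.e. non-decreasing) function of each of its variables. A symmetric mean $M(a,b,c)$ is (type 1) invariant with respect to $m(a,b)$ if $M(m(a,c),m(a,b),m(b,c))=M(a,b,c)$ for all $(a,b,c)\in\mathbb{R}_+^3$. *)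

(* Defs.v *)
(* MathComp-Analysis, over an arbitrary [R : realType]. *)
From HB Require Import structures.
From mathcomp Require Import all_boot all_order all_algebra all_fingroup.
From mathcomp Require Import all_classical all_reals all_analysis.

Set Implicit Arguments.
Unset Strict Implicit.
Unset Printing Implicit Defensive.

Import Order.TTheory GRing.Theory Num.Theory.
Import numFieldNormedType.Exports.

Local Open Scope classical_set_scope.
Local Open Scope ring_scope.

(* A function of n variables on the open positive orthant is a total function
   on row vectors, whose values outside [orthant] are never used: every notion
   below only depends on the restriction to [orthant]. *)
Definition orthant (R : realType) (n : nat) : set 'rV[R]_n :=
  [set a | forall i, 0 < a 0 i].
Arguments orthant R n : clear implicits.

(* The number of variables is n.+1, so that min and max exist; the default
   element of each big operator is itself one of the entries. *)
Definition vmin (R : realType) (n : nat) (a : 'rV[R]_n.+1) : R :=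
  \big[Num.min/a 0 0]_(i < n.+1) a 0 i.

Definition vmax (R : realType) (n : nat) (a : 'rV[R]_n.+1) : R :=
  \big[Num.max/a 0 0]_(i < n.+1) a 0 i.

Definition is_mean (R : realType) (n : nat) (m : 'rV[R]_n.+1 -> R) : Prop :=
  {within orthant R n.+1, continuous m} /\
  forall a, orthant R n.+1 a -> vmin a <= m a <= vmax a.

Definition is_symmetric (R : realType) (n : nat) (m : 'rV[R]_n.+1 -> R) : Prop :=
  forall (s : 'S_n.+1) a, orthant R n.+1 a -> m (col_perm s a) = m a.

Definition is_strict (R : realType) (n : nat) (m : 'rV[R]_n.+1 -> R) : Prop :=
  forall a, orthant R n.+1 a ->
    (m a = vmin a \/ m a = vmax a) <-> (forall i j, a 0 i = a 0 j).

Definition is_isotone (R : realType) (n : nat) (m : 'rV[R]_n.+1 -> R) : Prop :=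
  forall (i : 'I_n.+1) a a', orthant R n.+1 a -> orthant R n.+1 a' ->
    (forall j, j != i -> a 0 j = a' 0 j) -> a 0 i <= a' 0 i -> m a <= m a'.

Definition row2 (R : realType) (a b : R) : 'rV[R]_2 :=
  \row_(i < 2) [:: a; b]`_i.

Definition row3 (R : realType) (a b c : R) : 'rV[R]_3 :=
  \row_(i < 3) [:: a; b; c]`_i.

(* Type 1 invariance is a property of symmetric means only, hence the first two
   conjuncts. *)
Definition is_invariant (R : realType) (M : 'rV[R]_3 -> R) (m : 'rV[R]_2 -> R) :
    Prop :=
  [/\ is_mean M, is_symmetric M &
      forall a b c : R, 0 < a -> 0 < b -> 0 < c ->
        M (row3 (m (row2 a c)) (m (row2 a b)) (m (row2 b c))) = M (row3 a b c)].

Fixpoint abc (R : realType) (m : 'rV[R]_2 -> R) (a b c : R) (n : nat) :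
    R * R * R :=
  if n is k.+1 then
    let: (ak, bk, ck) := abc m a b c k in
    (m (row2 ak ck), m (row2 ck bk), m (row2 ak bk))
  else (a, b, c).

Definition a_ (R : realType) (m : 'rV[R]_2 -> R) (a b c : R) : R^nat :=
  fun n => (abc m a b c n).1.1.

Definition b_ (R : realType) (m : 'rV[R]_2 -> R) (a b c : R) : R^nat :=
  fun n => (abc m a b c n).1.2.

Definition c_ (R : realType) (m : 'rV[R]_2 -> R) (a b c : R) : R^nat :=
  fun n => (abc m a b c n).2.

(* [lim] is total; that this is the common limit of the three sequences has to
   be proved from the hypotheses on m. *)
Definition L (R : realType) (m : 'rV[R]_2 -> R) (a b c : R) : R :=
  lim (a_ m a b c @ \oo).

(* Main.v *)
(* Up to permutation, one step of the iteration maps a triple x >= y >= z to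
   f x y >= f x z >= f y z, where f is the mean m: the largest entries decrease,
   the least ones increase, and continuity and strictness force a common limit.
   That limit depends only on the sorted triple, hence is symmetric and
   invariant, and it is continuous because it is squeezed between the continuous
   extreme entries of every iterate. An invariant mean is constant along the
   iteration and squeezed between the same extreme entries, hence equals L. *)
Require Import Defs.
From HB Require Import structures.
From mathcomp Require Import all_boot all_order all_algebra all_fingroup.
From mathcomp Require Import all_classical all_reals all_analysis.
From mathcomp Require Import lra.

Set Implicit Arguments.
Unset Strict Implicit.
Unset Printing Implicit Defensive.

Import Order.TTheory GRing.Theory Num.Theory.
Import numFieldNormedType.Exports.

Local Open Scope classical_set_scope.
Local Open Scope ring_scope.

(** * Sorting triples of reals *)

(** The middle component is the median, written as the largest of the pairwise minima. With only
    [min] and [max], symmetry follows from lattice identities and continuity from that of [min] and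
    [max]. *)
Definition sort3 (R : realType) (a b c : R) : R * R * R :=
  (Num.max a (Num.max b c),
   Num.max (Num.min a b) (Num.max (Num.min a c) (Num.min b c)),
   Num.min a (Num.min b c)).

Lemma sort3C (R : realType) (a b c : R) : sort3 b a c = sort3 a b c.
Proof.
by rewrite /sort3 maxCA minCA (minC b a) (maxC (Num.min a c)).
Qed.

Lemma sort3CA (R : realType) (a b c : R) : sort3 a c b = sort3 a b c.
Proof.
by rewrite /sort3 (maxC c b) (minC c b) (maxCA (Num.min a c)).
Qed.

Lemma sort3_id (R : realType) (x y z : R) :
  z <= y -> y <= x -> sort3 x y z = (x, y, z).
Proof.
move=> zy yx; have zx := le_trans zy yx.
by rewrite /sort3 (min_r yx) (min_r zy) (min_r zx) (max_l zy) !max_l.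
Qed.

(** The two adjacent transpositions generate all permutations of three arguments, so a property
    stable under both need only be checked on sorted triples. *)
Lemma sort3_ind (R : realType) (P : R -> R -> R -> Prop) :
    (forall a b c, P a b c -> P b a c) -> (forall a b c, P a b c -> P a c b) ->
    (forall a b c, c <= b -> b <= a -> P a b c) ->
  forall a b c, P a b c.
Proof.
move=> P12 P23 Ple a b c.
have Pab a' b' c' : b' <= a' -> P a' b' c'.
  move=> ba; have [cb|/ltW bc] := leP c' b'; first exact: Ple.
  by have [ca|/ltW ac] := leP c' a'; [apply/P23/Ple|apply/P23/P12/Ple].
by have [ba|/ltW ab] := leP b a; [exact: Pab|apply/P12/Pab].
Qed.

(** Positivity is included so that this invariant of the iteration keeps the entries where the
    properties of the mean apply. *)
Definition decr (R : realType) (t : R * R * R) : Prop :=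
  [/\ 0 < t.2, t.2 <= t.1.2 & t.1.2 <= t.1.1].

Lemma decr_sort3 (R : realType) (a b c : R) :
  0 < a -> 0 < b -> 0 < c -> decr (sort3 a b c).
Proof.
move: a b c; apply: sort3_ind => a b c.
- by move=> IH b0 a0 c0; rewrite sort3C; exact: IH.
- by move=> IH a0 c0 b0; rewrite sort3CA; exact: IH.
- by move=> cb ba a0 b0 c0; rewrite sort3_id.
Qed.

(** * Two-variable means and the iteration on sorted triples *)

(* The bounds and strictness are only required for y <= x; the other case
   follows by symmetry. *)
Record mean2 (R : realType) (f : R -> R -> R) : Prop := {
  mean2C : forall x y, 0 < x -> 0 < y -> f x y = f y x;
  mean2_ge : forall x y, 0 < y -> y <= x -> y <= f x y;
  mean2_le : forall x y, 0 < y -> y <= x -> f x y <= x;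
  mean2_eqr : forall x y, 0 < y -> y <= x -> f x y = y -> x = y;
  mean2_eql : forall x y, 0 < y -> y <= x -> f x y = x -> x = y;
  mean2_monol : forall x x' y, 0 < x -> 0 < y -> x <= x' -> f x y <= f x' y;
  mean2_cont : forall p : R * R, 0 < p.1 -> 0 < p.2 ->
    {for p, continuous (fun q : R * R => f q.1 q.2)} }.

Lemma mean2_monor (R : realType) (f : R -> R -> R) (hf : mean2 f) x y y' :
  0 < x -> 0 < y -> y <= y' -> f x y <= f x y'.
Proof.
move=> x0 y0 yy'; rewrite !(mean2C hf x0)//; first exact: mean2_monol.
exact: lt_le_trans yy'.
Qed.

Lemma mean2_gt0 (R : realType) (f : R -> R -> R) (hf : mean2 f) x y :
  0 < x -> 0 < y -> 0 < f x y.
Proof.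
move=> x0 y0; have [yx|/ltW xy] := leP y x.
  exact: lt_le_trans (mean2_ge hf y0 yx).
by rewrite (mean2C hf)//; apply: lt_le_trans (mean2_ge hf x0 xy).
Qed.

(* The iteration, read on triples x >= y >= z: see [sort3_step]. *)
Definition sorted_step (R : realType) (f : R -> R -> R) (t : R * R * R) : R * R * R :=
  (f t.1.1 t.1.2, f t.1.1 t.2, f t.1.2 t.2).

(** Transposing two of [a], [b], [c] only permutes the three new values, since [f] is symmetric. For
    [a >= b >= c], monotonicity gives [f a b >= f a c >= f b c]. *)
Lemma sort3_step (R : realType) (f : R -> R -> R) (hf : mean2 f) a b c :
    0 < a -> 0 < b -> 0 < c ->
  sort3 (f a c) (f c b) (f a b) = sorted_step f (sort3 a b c).
Proof.
move: a b c; apply: sort3_ind => a b c.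
- move=> IH b0 a0 c0; rewrite (sort3C a b c) -IH//.
  by rewrite (mean2C hf b0 c0) (mean2C hf c0 a0) (mean2C hf b0 a0) sort3C.
- move=> IH a0 c0 b0; rewrite (sort3CA a b c) -IH// (mean2C hf b0 c0).
  by rewrite sort3CA sort3C sort3CA.
- move=> cb ba a0 b0 c0; rewrite [in RHS]sort3_id//= sort3CA sort3C.
  rewrite (mean2C hf c0 b0) sort3_id//; first exact: mean2_monol.
  exact: mean2_monor.
Qed.

Lemma decr_step (R : realType) (f : R -> R -> R) (hf : mean2 f) t :
  decr t -> decr (sorted_step f t).
Proof.
case: t => -[x y] z [/= z0 zy yx].
have y0 := lt_le_trans z0 zy; have x0 := lt_le_trans y0 yx.
split => /=; [exact: mean2_gt0|exact: mean2_monol|exact: mean2_monor].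
Qed.

Lemma decr_iter (R : realType) (f : R -> R -> R) (hf : mean2 f) n t :
  decr t -> decr (iter n (sorted_step f) t).
Proof. by move=> dt; elim: n => //= n; exact: decr_step. Qed.

(** * Convergence of the sorted iteration *)

Lemma cvg_mean2 (R : realType) (f : R -> R -> R) (hf : mean2 f)
    (T : Type) (F : set_system T) {FF : Filter F} (u v : T -> R) (x y : R) :
  0 < x -> 0 < y -> u @ F --> x -> v @ F --> y ->
  (fun t => f (u t) (v t)) @ F --> f x y.
Proof.
move=> x0 y0 ux vy.
exact: (cvg_comp _ _ (cvg_pair ux vy) (@mean2_cont _ _ hf (x, y) x0 y0)).
Qed.

Lemma nonincreasing_iter_step (R : realType) (f : R -> R -> R) (hf : mean2 f) t :
  decr t -> nonincreasing_seq (fun n => (iter n (sorted_step f) t).1.1).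
Proof.
move=> dt; apply/nonincreasing_seqP => n /=.
have [z0 zy yx] := decr_iter hf n dt.
exact: (mean2_le hf (lt_le_trans z0 zy) yx).
Qed.

Lemma nondecreasing_iter_step (R : realType) (f : R -> R -> R) (hf : mean2 f) t :
  decr t -> nondecreasing_seq (fun n => (iter n (sorted_step f) t).2).
Proof.
move=> dt; apply/nondecreasing_seqP => n /=.
by have [z0 zy _] := decr_iter hf n dt; exact: (mean2_ge hf).
Qed.

Lemma cvgn_of_shift (R : realType) (u : R^nat) (l : R) :
  (fun n => u n.+1) @ \oo --> l -> u @ \oo --> l.
Proof. by rewrite cvg_shiftS. Qed.

(* If the largest and least entries tend to X and Z then, by continuity, the
   middle one tends to Y = f X Z, whence X = f X Y and Z = f Y Z, and strictness
   gives X = Y = Z. *)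
Lemma cvg_iter_step (R : realType) (f : R -> R -> R) (hf : mean2 f) t :
  decr t -> exists l : R,
    (fun n => (iter n (sorted_step f) t).1.1) @ \oo --> l /\
    (fun n => (iter n (sorted_step f) t).2) @ \oo --> l.
Proof.
move=> dt; set x := fun n => (iter n (sorted_step f) t).1.1.
set z := fun n => (iter n (sorted_step f) t).2.
pose y := fun n => (iter n (sorted_step f) t).1.2.
have x_dec := nonincreasing_iter_step hf dt.
have z_inc := nondecreasing_iter_step hf dt.
have zx n : z n <= x n by have [_ zy yx] := decr_iter hf n dt; exact: le_trans yx.
have z0 : 0 < z 0%N by case: dt.
have cx : cvgn x.
  apply: nonincreasing_is_cvgn => //; exists (z 0%N) => _ [n _ <-].
  by apply: le_trans (zx n); exact: z_inc.
have cz : cvgn z.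
  apply: nondecreasing_is_cvgn => //; exists (x 0%N) => _ [n _ <-].
  by apply: le_trans (zx n) _; exact: x_dec.
set X := limn x in cx *; set Z := limn z in cz *.
have Z0 : 0 < Z by apply: lt_le_trans z0 _; exact: nondecreasing_cvgn_le.
have ZX : Z <= X by apply: ler_lim => //; near=> n.
have X0 := lt_le_trans Z0 ZX.
have YX := mean2_le hf Z0 ZX; have ZY := mean2_ge hf Z0 ZX.
have Y0 := lt_le_trans Z0 ZY.
have cy : y @ \oo --> f X Z.
  by apply: cvgn_of_shift; exact: cvg_mean2.
have eX : f X (f X Z) = X.
  apply: (@cvg_unique _ _ (x @ \oo)) => //.
  by apply: cvgn_of_shift; exact: cvg_mean2.
have eZ : f (f X Z) Z = Z.
  apply: (@cvg_unique _ _ (z @ \oo)) => //.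
  by apply: cvgn_of_shift; exact: cvg_mean2.
exists X; split => //.
by rewrite (mean2_eql hf Y0 YX eX) (mean2_eqr hf Z0 ZY eZ).
Unshelve. all: by end_near. Qed.

(** * Continuity of the iterates in the starting triple *)

Lemma continuous_step (R : realType) (f : R -> R -> R) (hf : mean2 f) t :
  decr t -> {for t, continuous (sorted_step f)}.
Proof.
case=> z0 zy yx; have y0 := lt_le_trans z0 zy; have x0 := lt_le_trans y0 yx.
have c1 : (fun p : R * R * R => p.1.1) @ t --> t.1.1.
  by apply: (cvg_comp fst fst); exact: cvg_fst.
have c2 : (fun p : R * R * R => p.1.2) @ t --> t.1.2.
  by apply: (cvg_comp fst snd); [exact: cvg_fst|exact: cvg_snd].
have c3 : (fun p : R * R * R => p.2) @ t --> t.2 by exact: cvg_snd.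
have c12 : (fun p : R * R * R => f p.1.1 p.1.2) @ t --> f t.1.1 t.1.2.
  exact: cvg_mean2.
have c13 : (fun p : R * R * R => f p.1.1 p.2) @ t --> f t.1.1 t.2.
  exact: cvg_mean2.
have c23 : (fun p : R * R * R => f p.1.2 p.2) @ t --> f t.1.2 t.2.
  exact: cvg_mean2.
exact: (cvg_pair (cvg_pair c12 c13) c23).
Qed.

Lemma continuous_iter_step (R : realType) (f : R -> R -> R) (hf : mean2 f) n t :
  decr t -> {for t, continuous (iter n (sorted_step f))}.
Proof.
move=> dt; elim: n => [|n IH]; first exact: (@cvg_id _ (nbhs t)).
exact: (cvg_comp _ _ IH (continuous_step hf (decr_iter hf n dt))).
Qed.

(** * Row vectors of length two and three *)

Lemma sort3_perm (R : realType) (g : 'I_3 -> R) (s : 'S_3) :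
  sort3 (g (s 0)) (g (s 1)) (g (s 2)) = sort3 (g 0) (g 1) (g 2).
Proof.
have i012 (i : 'I_3) : [\/ i = 0, i = 1 | i = 2].
  by case: i => -[|[|[|//]]] i3; [apply: Or31|apply: Or32|apply: Or33]; exact: val_inj.
have : [/\ s 0 != s 1, s 0 != s 2 & s 1 != s 2] by rewrite !(inj_eq perm_inj).
(* Of the 27 value patterns, injectivity leaves six; the identity is closed at once and the other
   five are products of adjacent transpositions. *)
case: (i012 (s 0)) => ->; case: (i012 (s 1)) => ->; case: (i012 (s 2)) => -> [] //.
- by rewrite sort3CA.
- by rewrite sort3C.
- by rewrite sort3CA sort3C.
- by rewrite sort3C sort3CA.
- by rewrite sort3C sort3CA sort3C.
Qed.

Lemma vmin_row3 (R : realType) (v : 'rV[R]_3) :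
  vmin v = (sort3 (v 0 0) (v 0 1) (v 0 2)).2.
Proof.
rewrite /vmin !big_ord_recl big_ord0 /=.
have -> : lift ord0 ord0 = 1 :> 'I_3 by exact: val_inj.
have -> : lift ord0 (lift ord0 ord0) = 2 :> 'I_3 by exact: val_inj.
(* The default of the big operator makes [v 0 0] occur twice; the two copies are brought together
   and merged. *)
by rewrite (minC (v 0 2)) [in LHS](minCA (v 0 1)) (minA (v 0 0) (v 0 0)) minxx.
Qed.

Lemma vmax_row3 (R : realType) (v : 'rV[R]_3) :
  vmax v = (sort3 (v 0 0) (v 0 1) (v 0 2)).1.1.
Proof.
rewrite /vmax !big_ord_recl big_ord0 /=.
have -> : lift ord0 ord0 = 1 :> 'I_3 by exact: val_inj.
have -> : lift ord0 (lift ord0 ord0) = 2 :> 'I_3 by exact: val_inj.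
by rewrite (maxC (v 0 2)) [in LHS](maxCA (v 0 1)) (maxA (v 0 0) (v 0 0)) maxxx.
Qed.

Lemma vmin_row2 (R : realType) (x y : R) : vmin (row2 x y) = Num.min x y.
Proof. by rewrite /vmin !big_ord_recl big_ord0 !mxE/= minCA minxx minC. Qed.

Lemma vmax_row2 (R : realType) (x y : R) : vmax (row2 x y) = Num.max x y.
Proof. by rewrite /vmax !big_ord_recl big_ord0 !mxE/= maxCA maxxx maxC. Qed.

Lemma orthant_row2 (R : realType) (x y : R) :
  0 < x -> 0 < y -> orthant R 2 (row2 x y).
Proof. by move=> x0 y0 i; rewrite mxE; case: i => -[|[|]]. Qed.

Lemma orthant_row3 (R : realType) (x y z : R) :
  0 < x -> 0 < y -> 0 < z -> orthant R 3 (row3 x y z).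
Proof. by move=> x0 y0 z0 i; rewrite mxE; case: i => -[|[|[|]]]. Qed.

Lemma open_orthant (R : realType) n : open (orthant R n).
Proof.
rewrite openE => v v0; exists (fun _ j => [set x | 0 < x]) => [i j|w + j]; last exact.
by rewrite ord1; apply: open_nbhs_nbhs; split; [exact: open_gt|exact: v0].
Qed.

(** A neighbourhood of a row vector contains a box, given by one neighbourhood [P 0 j] per entry;
    the product of these is the required neighbourhood of the pair. *)
Lemma continuous_row2 (R : realType) : continuous (fun p : R * R => row2 p.1 p.2).
Proof.
move=> p A [P nP PA]; apply: filterS (_ : nbhs p [set q | P 0 0 q.1 /\ P 0 1 q.2]).
  move=> q [P0 P1]; apply: PA => i j; rewrite ord1 mxE.
  by case: j => -[|[|//]] j2 /=; [move: P0|move: P1]; congr (P _ _ _); exact: val_inj.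
have := nP 0 0; have := nP 0 1; rewrite !mxE/= => n1 n0.
by exists (P 0 0, P 0 1) => // -[].
Qed.

Lemma mean2_row2 (R : realType) (m : 'rV[R]_2 -> R) :
  is_mean m -> is_strict m -> is_isotone m -> is_symmetric m ->
  mean2 (fun x y => m (row2 x y)).
Proof.
move=> [mcont mmean] mstrict miso msym.
have bounds x y : 0 < y -> y <= x -> y <= m (row2 x y) <= x.
  move=> y0 yx; have := mmean _ (orthant_row2 (lt_le_trans y0 yx) y0).
  by rewrite vmin_row2 vmax_row2 (min_r yx) (max_l yx).
have strict x y : 0 < y -> y <= x -> m (row2 x y) = y \/ m (row2 x y) = x -> x = y.
  move=> y0 yx myx; have [+ _] := mstrict _ (orthant_row2 (lt_le_trans y0 yx) y0).
  rewrite vmin_row2 vmax_row2 (min_r yx) (max_l yx) => /(_ myx 0 1).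
  by rewrite !mxE.
split.
- move=> x y x0 y0; rewrite -(msym (tperm 0 1)); last exact: orthant_row2.
  congr m; apply/rowP => -[[|[|//]] i2]; rewrite !mxE /=.
    by rewrite (_ : Ordinal _ = 0) ?tpermL//; exact: val_inj.
  by rewrite (_ : Ordinal _ = 1) ?tpermR//; exact: val_inj.
- by move=> x y y0 yx; case/andP: (bounds _ _ y0 yx).
- by move=> x y y0 yx; case/andP: (bounds _ _ y0 yx).
- by move=> x y y0 yx e; apply: strict => //; left.
- by move=> x y y0 yx e; apply: strict => //; right.
- move=> x x' y x0 y0 xx'; apply: (miso 0).
  + exact: orthant_row2.
  + by apply: orthant_row2 => //; exact: lt_le_trans xx'.
  + by move=> -[[|[|//]] j2] //; rewrite !mxE.
  + by rewrite !mxE.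
- move=> p p1 p2; apply: (cvg_comp _ _ (@continuous_row2 R p)).
  (* The orthant is open, so continuity within it is continuity at each of its points. *)
  move: mcont; rewrite (continuous_open_subspace _ (@open_orthant R 2)).
  by apply; rewrite inE; exact: orthant_row2.
Qed.

(** * The three sequences and their limit *)

Lemma abc_gt0 (R : realType) (m : 'rV[R]_2 -> R) a b c n :
  mean2 (fun x y => m (row2 x y)) -> 0 < a -> 0 < b -> 0 < c ->
  [/\ 0 < a_ m a b c n, 0 < b_ m a b c n & 0 < c_ m a b c n].
Proof.
rewrite /a_ /b_ /c_ => hm a0 b0 c0; elim: n => //= n.
case: (abc m a b c n) => -[x y] z /= [x0 y0 z0].
by split; exact: (mean2_gt0 hm).
Qed.

Definition sorted_abc (R : realType) (m : 'rV[R]_2 -> R) a b c n : R * R * R :=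
  iter n (sorted_step (fun x y => m (row2 x y))) (sort3 a b c).

Lemma sort3_abc (R : realType) (m : 'rV[R]_2 -> R) a b c n :
  mean2 (fun x y => m (row2 x y)) -> 0 < a -> 0 < b -> 0 < c ->
  sort3 (a_ m a b c n) (b_ m a b c n) (c_ m a b c n) =
  sorted_abc m a b c n.
Proof.
rewrite /sorted_abc => hm a0 b0 c0; elim: n => //= n <-.
have := abc_gt0 n hm a0 b0 c0; rewrite /a_ /b_ /c_ /=.
case: (abc m a b c n) => -[x y] z /= [x0 y0 z0].
exact: (sort3_step hm).
Qed.

(** The recursion defining [abc] peels off the last step; this form peels off the first, so that a
    shifted sequence becomes a sequence with a new starting point. *)
Lemma abcS (R : realType) (m : 'rV[R]_2 -> R) a b c n :
  abc m a b c n.+1 = abc m (m (row2 a c)) (m (row2 c b)) (m (row2 a b)) n.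
Proof. by elim: n => // n IH; rewrite [LHS]/= -/(abc m a b c n.+1) IH. Qed.

Lemma sort3_bounds (R : realType) (a b c : R) :
  [/\ (sort3 a b c).2 <= a <= (sort3 a b c).1.1,
      (sort3 a b c).2 <= b <= (sort3 a b c).1.1 &
      (sort3 a b c).2 <= c <= (sort3 a b c).1.1].
Proof. by rewrite /sort3/= !ge_min !le_max !lexx !orbT. Qed.

(** Each sequence is squeezed between the least and largest entries of the sorted iterates, which
    share a limit. That limit is [L] because [L] is the limit of the first sequence. *)
Lemma cvg_abc (R : realType) (m : 'rV[R]_2 -> R) a b c :
  mean2 (fun x y => m (row2 x y)) -> 0 < a -> 0 < b -> 0 < c ->
  [/\ (fun n => (sorted_abc m a b c n).1.1) @ \oo --> L m a b c,
      (fun n => (sorted_abc m a b c n).2) @ \oo --> L m a b c &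
      [/\ a_ m a b c @ \oo --> L m a b c, b_ m a b c @ \oo --> L m a b c &
      c_ m a b c @ \oo --> L m a b c]].
Proof.
move=> hm a0 b0 c0.
have [l [xl zl]] := cvg_iter_step hm (decr_sort3 a0 b0 c0).
have bounds n := sort3_bounds (a_ m a b c n) (b_ m a b c n) (c_ m a b c n).
have al : a_ m a b c @ \oo --> l.
  apply: (squeeze_cvgr _ zl xl); apply: nearW => n.
  by have [+ _ _] := bounds n; rewrite sort3_abc.
have bl : b_ m a b c @ \oo --> l.
  apply: (squeeze_cvgr _ zl xl); apply: nearW => n.
  by have [_ + _] := bounds n; rewrite sort3_abc.
have cl : c_ m a b c @ \oo --> l.
  apply: (squeeze_cvgr _ zl xl); apply: nearW => n.
  by have [_ _ +] := bounds n; rewrite sort3_abc.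
by have -> : L m a b c = l by exact/cvg_lim.
Qed.

Lemma L_sort3 (R : realType) (m : 'rV[R]_2 -> R) a b c a' b' c' :
  mean2 (fun x y => m (row2 x y)) -> 0 < a -> 0 < b -> 0 < c ->
  0 < a' -> 0 < b' -> 0 < c' -> sort3 a b c = sort3 a' b' c' ->
  L m a b c = L m a' b' c'.
Proof.
move=> hm a0 b0 c0 a0' b0' c0' e.
have [h _ _] := cvg_abc hm a0 b0 c0; have [h' _ _] := cvg_abc hm a0' b0' c0'.
by apply: (cvg_unique _ h); rewrite // /sorted_abc e.
Qed.

Lemma L_step (R : realType) (m : 'rV[R]_2 -> R) a b c :
  mean2 (fun x y => m (row2 x y)) -> 0 < a -> 0 < b -> 0 < c ->
  L m (m (row2 a c)) (m (row2 c b)) (m (row2 a b)) = L m a b c.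
Proof.
move=> hm a0 b0 c0.
have [_ _ [h _ _]] := cvg_abc hm a0 b0 c0.
apply/cvg_lim => //; move: h; rewrite -cvg_shiftS.
by under eq_fun do rewrite /a_ abcS.
Qed.

(** A monotone sequence stays on one side of its limit. The case [n = 0] gives the mean
    inequalities, large [n] the continuity of [L]. *)
Lemma L_bounds (R : realType) (m : 'rV[R]_2 -> R) a b c n :
  mean2 (fun x y => m (row2 x y)) -> 0 < a -> 0 < b -> 0 < c ->
  (sorted_abc m a b c n).2 <= L m a b c <= (sorted_abc m a b c n).1.1.
Proof.
move=> hm a0 b0 c0; have dt := decr_sort3 a0 b0 c0.
have [hx hz _] := cvg_abc hm a0 b0 c0.
apply/andP; split.
- rewrite -(cvg_lim _ hz)//; apply: nondecreasing_cvgn_le.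
    exact: nondecreasing_iter_step.
  by apply/cvg_ex; exists (L m a b c).
- rewrite -(cvg_lim _ hx)//; apply: nonincreasing_cvgn_ge.
    exact: nonincreasing_iter_step.
  by apply/cvg_ex; exists (L m a b c).
Qed.

(** * Continuity of the limit in the starting triple *)

Lemma continuous_sort3 (R : realType) (T : topologicalType) (u v w : T -> R) x :
  {for x, continuous u} -> {for x, continuous v} -> {for x, continuous w} ->
  {for x, continuous (fun y => sort3 (u y) (v y) (w y))}.
Proof.
move=> cu cv cw.
have cmin f g : {for x, continuous f} -> {for x, continuous g} ->
    {for x, continuous (fun y => Num.min (f y) (g y) : R)}.
  exact: continuous_min.
have cmax f g : {for x, continuous f} -> {for x, continuous g} ->
    {for x, continuous (fun y => Num.max (f y) (g y) : R)}.
  exact: continuous_max.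
have c1 := cmax _ _ cu (cmax _ _ cv cw).
have c2 := cmax _ _ (cmin _ _ cu cv) (cmax _ _ (cmin _ _ cu cw) (cmin _ _ cv cw)).
have c3 := cmin _ _ cu (cmin _ _ cv cw).
exact: (cvg_pair (cvg_pair c1 c2) c3).
Qed.

(* L lies between the extreme entries of the n-th iterate, which are continuous
   in the starting point and as close as desired for n large. *)
Lemma continuous_L (R : realType) (m : 'rV[R]_2 -> R) (v : 'rV[R]_3) :
  mean2 (fun x y => m (row2 x y)) -> orthant R 3 v ->
  {for v, continuous (fun w : 'rV[R]_3 => L m (w 0 0) (w 0 1) (w 0 2))}.
Proof.
move=> hm v0; set l := fun w : 'rV_3 => _.
pose s n (w : 'rV[R]_3) := sorted_abc m (w 0 0) (w 0 1) (w 0 2) n.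
have cs n : {for v, continuous (s n)}.
  have cs0 : {for v, continuous (fun w : 'rV[R]_3 => sort3 (w 0 0) (w 0 1) (w 0 2))}.
    by apply: continuous_sort3; exact: coord_continuous.
  have dv := decr_sort3 (v0 0) (v0 1) (v0 2).
  exact: (cvg_comp _ _ cs0 (@continuous_iter_step _ _ hm n _ dv)).
have chi n : {for v, continuous (fun w => (s n w).1.1)}.
  have c11 : (fun t : R * R * R => t.1.1) @ s n v --> (s n v).1.1.
    by apply: (cvg_comp fst fst); exact: cvg_fst.
  exact: (cvg_comp _ _ (cs n) c11).
have clo n : {for v, continuous (fun w => (s n w).2)}.
  have c2 : (fun t : R * R * R => t.2) @ s n v --> (s n v).2 by exact: cvg_snd.
  exact: (cvg_comp _ _ (cs n) c2).
have [xl zl _] := cvg_abc hm (v0 0) (v0 1) (v0 2).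
apply/(@cvgrPdist_lt _ _ _ (nbhs v)) => e e0; have e20 : 0 < e / 2 by rewrite divr_gt0.
(* The index [n] is chosen at [v] alone and then fixed; only afterwards does [w] vary near [v], so
   continuity of a single iterate suffices. *)
have [n [xe ze]] : exists n, (s n v).1.1 < l v + e / 2 /\ l v - e / 2 < (s n v).2.
  near \oo => n; exists n; split.
    by near: n; apply: (cvgr_lt _ xl); rewrite ltrDl.
  by near: n; apply: (cvgr_gt _ zl); rewrite gtrBl.
near=> w.
have w0 : orthant R 3 w.
  near: w; apply: open_nbhs_nbhs; split => //; exact: open_orthant.
have /andP[lo hi] := L_bounds n hm (w0 0) (w0 1) (w0 2).
have hi' : (s n w).1.1 < l v + e / 2 by near: w; exact: (cvgr_lt _ (chi n)).
have lo' : l v - e / 2 < (s n w).2 by near: w; exact: (cvgr_gt _ (clo n)).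
have lw1 : l w < l v + e / 2 := le_lt_trans hi hi'.
have lw2 : l v - e / 2 < l w := lt_le_trans lo' lo.
rewrite ltr_distl; apply/andP; split; lra.
Unshelve. all: by end_near. Qed.

(** * Uniqueness of the invariant mean *)

Lemma row3_coord (R : realType) (a b c : R) :
  (row3 a b c 0 0 = a) * (row3 a b c 0 1 = b) * (row3 a b c 0 2 = c).
Proof. by rewrite !mxE. Qed.

Lemma invariant_eq_L (R : realType) (m : 'rV[R]_2 -> R) (M : 'rV[R]_3 -> R) a b c :
  mean2 (fun x y => m (row2 x y)) -> is_invariant M m ->
  0 < a -> 0 < b -> 0 < c -> M (row3 a b c) = L m a b c.
Proof.
move=> hm [[_ Mmean] Msym Minv] a0 b0 c0.
(* Invariance lists the new values with the last two in the opposite order to the iteration;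
   symmetry of [M] reconciles them. *)
have M23 x y z : 0 < x -> 0 < y -> 0 < z -> M (row3 x z y) = M (row3 x y z).
  move=> x0 y0 z0; rewrite -(Msym (tperm 1 2)); last exact: orthant_row3.
  congr M; apply/rowP => i; rewrite mxE.
  case: tpermP => [->|->|]; rewrite ?row3_coord// !mxE.
  by case: i => -[|[|[|//]]] i3 //= i1 i2; [case: i1|case: i2]; exact: val_inj.
pose t n := row3 (a_ m a b c n) (b_ m a b c n) (c_ m a b c n).
have Mt n : M (t n) = M (row3 a b c).
  elim: n => // n <-; have := abc_gt0 n hm a0 b0 c0.
  rewrite /t /a_ /b_ /c_ /=.
  case: (abc m a b c n) => -[x y] z /= [x0 y0 z0].
  have pos := mean2_gt0 hm; rewrite -(Minv x y z)// M23 ?pos//.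
  by rewrite (mean2C hm z0 y0).
have [xl zl _] := cvg_abc hm a0 b0 c0.
(* The constant sequence [M (t n)] tends to [M (row3 a b c)], and also to [L], being squeezed
   between the extreme entries. *)
apply: (@cvg_unique _ (@Rhausdorff R) ((fun n => M (t n)) @ \oo)).
  by rewrite (_ : (fun n => _) = cst (M (row3 a b c))); [exact: cvg_cst|exact/funext].
apply: (squeeze_cvgr _ zl xl); apply: nearW => n.
have [an bn cn] := abc_gt0 n hm a0 b0 c0.
have := Mmean _ (orthant_row3 an bn cn).
by rewrite vmin_row3 vmax_row3 !row3_coord sort3_abc.
Qed.

Theorem theorem2 (R : realType) (m : 'rV[R]_2 -> R)
    (m_mean : is_mean m) (m_strict : is_strict m)
    (m_isotone : is_isotone m) (m_sym : is_symmetric m) :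
  [/\ (* the three sequences converge to the common limit L *)
      forall a b c : R, 0 < a -> 0 < b -> 0 < c ->
        [/\ a_ m a b c @ \oo --> L m a b c,
            b_ m a b c @ \oo --> L m a b c &
            c_ m a b c @ \oo --> L m a b c],
      (* (A) *)
      (let M := fun v : 'rV[R]_3 => L m (v 0 0) (v 0 1) (v 0 2) in
       is_mean M /\ is_invariant M m) &
      (* (B) *)
      forall M : 'rV[R]_3 -> R, is_mean M -> is_invariant M m ->
        forall a b c : R, 0 < a -> 0 < b -> 0 < c ->
          M (row3 a b c) = L m a b c].
Proof.
have hm := mean2_row2 m_mean m_strict m_isotone m_sym.
split; last by move=> M _ HM a b c; exact: invariant_eq_L.
  by move=> a b c a0 b0 c0; have [] := cvg_abc hm a0 b0 c0.
move=> M.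
have Mmean : is_mean M.
  split=> [|v v0].
    rewrite (continuous_open_subspace _ (@open_orthant R 3)) => v /[!inE] v0.
    exact: continuous_L.
  (* The iterate of index 0 is the sorted triple itself, whose extreme entries are [vmin v] and
     [vmax v]. *)
  by rewrite vmin_row3 vmax_row3; exact: (L_bounds 0 hm).
split=> //; split=> // [s v v0|a b c a0 b0 c0].
  have p i : 0 < col_perm s v 0 i by rewrite mxE.
  apply: L_sort3 => //.
  by rewrite !mxE; exact: (sort3_perm (v 0)).
have pos := mean2_gt0 hm.
(* After one step of the iteration the two sides differ only by the order of the last two arguments,
   which [L] does not see. *)
rewrite /M !row3_coord -(L_step hm a0 b0 c0) (mean2C hm b0 c0).
by apply: L_sort3; rewrite ?pos// sort3CA.
Qed.
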